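(* Let $U=[0,1]$, $\Omega=(0,1)$, and let $f^{(n)}\in\mathcal{T}_n(U)$, $n\in\mathbb{N}$, be a sequence of step functions converging to $f$ in $L^2(U)$. Then $$\liminf_{n\to\infty}\sum_{\kappa=0}^{n-2}n\Big(f^{(n)}\big(\tfrac{\kappa+1}{n}\big)-f^{(n)}\big(\tfrac{\kappa}{n}\big)\Big)^2\ \ge\ \begin{cases}\int_0^1|f'(x)|^2dx & \text{if } f\in H^1(\Omega),\\ \infty & \text{if } f\notin H^1(\Omega).\end{cases}$$
   Context: $\mathcal{T}_n(U)$ is the set of (real-valued) functions on $U=[0,1]$ that are constant on each of the intervals $[\frac{\kappa}{n},\frac{\kappa+1}{n})$, $\kappa=0,\dots,n-2$, and on $[\frac{n-1}{n},1]$. $f'$ denotes the weak (Sobolev) derivative. *)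

(* Defs.v *)
(* Functions on a subset A of R are encoded as total
   functions R -> R of which only the values on A are used. *)
From HB Require Import structures.
From mathcomp Require Import all_boot all_order all_algebra.
From mathcomp Require Import all_classical all_reals all_analysis.

Set Implicit Arguments.
Unset Strict Implicit.
Unset Printing Implicit Defensive.

Import Order.TTheory GRing.Theory Num.Theory.
Import numFieldNormedType.Exports.

Local Open Scope classical_set_scope.
Local Open Scope ring_scope.

Section defs.
Context {R : realType}.
Implicit Types (A : set R) (f g phi : R -> R) (n : nat).

Local Notation mu := (@lebesgue_measure R).

Definition constant_on A g := forall x y, A x -> A y -> g x = g y.

(* meaningful for 0 < n only *)
Definition step_functions n : set (R -> R) :=
  [set g | (forall k, (k < n.-1)%N ->
              constant_on `[k%:R / n%:R, k.+1%:R / n%:R[ g) /\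
           constant_on `[n.-1%:R / n%:R, 1] g].

(* Outside of A, f \_ A takes the default value point = 0 of R. Functions
   represent their almost-everywhere classes. *)
Definition L2 A : set (R -> R) := [set f | f \_ A \in Lfun mu 2%:E].

Definition L2norm A f : \bar R := 'N[mu]_(2%:E)[EFin \o (f \_ A)]%E.

(* C_c^oo(A) *)
Definition test_functions A : set (R -> R) :=
  [set phi | (forall (k : nat) (x : R), derivable (derive1n k phi) x 1) /\
             compact (closure [set x | phi x != 0]) /\
             closure [set x | phi x != 0] `<=` A].

Definition is_weak_derivative A f g :=
  [/\ locally_integrable A f, locally_integrable A g &
      forall phi, test_functions A phi ->
        \int[mu]_(x in A) (f x * derive1 phi x) =
        - \int[mu]_(x in A) (g x * phi x)].

Definition sobolev_H1 A : set (R -> R) :=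
  [set f | L2 A f /\ exists2 g, L2 A g & is_weak_derivative A f g].

Definition step_energy n g : R :=
  \sum_(k < n.-1) n%:R * (g (k.+1%:R / n%:R) - g (k%:R / n%:R)) ^+ 2.

End defs.

(* Main.v *)
Require Import Defs.
From mathcomp Require Import all_boot all_order all_algebra.
From mathcomp Require Import all_classical all_reals all_analysis.
From mathcomp Require Import measurable_realfun.
From mathcomp Require Import ring lra.

Set Implicit Arguments.
Unset Strict Implicit.
Unset Printing Implicit Defensive.

Import Order.TTheory GRing.Theory Num.Theory.
Import numFieldNormedType.Exports.

Local Open Scope classical_set_scope.
Local Open Scope ring_scope.

(** The proof works by duality.  Write [F] for the restriction of [f] to [0, 1],
    [E n] for the discrete energy and [c] for its lower limit; only the case
    where [c] is finite has any content.

    Fix a test function [phi] on ]0, 1[.  On each cell [k/n, (k+1)/n[ the step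
    function is constant, so a summation by parts turns the integral of
    [fn n * phi'] into minus the sum of the jumps of [fn n] against the values
    of [phi] at the nodes.  By Cauchy-Schwarz the square of that sum is at most
    [E n] times a Riemann sum of [phi ^+ 2], and hence at most
    [E n * (|phi|^2 + L / n)] with [L] depending on [phi] alone
    ([dot_step_sqr_le]).  Strong convergence lets [n] go to infinity on the
    left, and the result is the estimate
      [(\int F phi')^2 <= c * |phi|^2]
    for every test function ([dot_derive1_le_energy]).

    This estimate says that [phi |-> - \int F phi'] is a linear form on the test
    functions, bounded by [sqrt c] for the quadratic norm.  It is represented by
    a square-integrable [g] with [|g|^2 <= c] ([riesz_subspace]), and the
    representation is exactly the statement that [g] is a weak derivative of [f]
    ([bounded_weak_derivative]).  Therefore a finite [c] forces [f] to be in
    H^1; and since weak derivatives are unique almost everywhere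
    ([weak_derivative_unique]), every weak derivative [f'] of [f] satisfies
    [|f'|^2 = |g|^2 <= c].

    Riesz representation is obtained by minimising [|phi|^2 - 2 Lam phi] over
    the subspace: the parallelogram identity makes minimising sequences Cauchy,
    and completeness is [riesz_fischer].  Uniqueness of weak derivatives rests
    on a supply of test functions, built from [exp (-1/x)]. *)

(** * The inner product of square-integrable functions *)

(** Evaluate the polynomial at its minimiser [- b / c]; if [c = 0] it is affine,
    and nonnegative only if its slope vanishes. *)
Lemma discriminant_le (R : realFieldType) (a b c : R) : 0 <= c ->
  (forall t, 0 <= a + 2 * t * b + t ^+ 2 * c) -> b ^+ 2 <= a * c.
Proof.
rewrite le_eqVlt => /predU1P[<- h|c0 h].
  have [->|bn0] := eqVneq b 0; first by rewrite expr0n mulr0.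
  have := h (- ((a + 1) / (2 * b))).
  by rewrite (_ : _ + _ = -1) ?ler0N1//; field.
have := h (- (b / c)); have cn0 : c != 0 by rewrite gt_eqF.
rewrite (_ : _ + _ = (a * c - b ^+ 2) / c); last by field.
by rewrite pmulr_lge0 ?invr_gt0// subr_ge0.
Qed.

Section dot.
Context d (T : measurableType d) (R : realType).
Variable mu : {measure set T -> \bar R}.
Implicit Types f g h : T -> R.

Local Notation Lfun2 := (Lfun mu 2%:E).

Definition dot f g : R := \int[mu]_x (f x * g x).

Lemma Lfun2_measurable f : f \in Lfun2 -> measurable_fun setT f.
Proof. by rewrite inE => /andP[/[!inE]]. Qed.

Lemma Lfun2D f g : f \in Lfun2 -> g \in Lfun2 -> f \+ g \in Lfun2.
Proof.
have [_ h] := @Lfun_addr_closed _ T R mu 2%:E (lee1n 2).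
exact: h.
Qed.

Lemma Lfun2Z a f : f \in Lfun2 -> a \*o f \in Lfun2.
Proof.
move=> fL2; rewrite (_ : _ \*o _ = a \o* f).
  by apply: Lfun_scale => //; rewrite ler1n.
by apply/funext => x /=; rewrite mulrC.
Qed.

Lemma Lfun2N f : f \in Lfun2 -> \- f \in Lfun2.
Proof.
move=> /(Lfun2Z (-1)); rewrite (_ : _ \*o f = \- f)//.
by apply/funext => x /=; rewrite mulN1r.
Qed.

Lemma Lfun2B f g : f \in Lfun2 -> g \in Lfun2 -> f \- g \in Lfun2.
Proof. by move=> fL2 gL2; apply: Lfun2D => //; exact: Lfun2N. Qed.

Lemma integrable_dot f g : f \in Lfun2 -> g \in Lfun2 ->
  mu.-integrable setT (EFin \o (fun x => f x * g x)).
Proof. by move=> fL2 gL2; apply/Lfun1_integrable; exact: Lfun2_mul_Lfun1. Qed.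

Lemma dotC f g : dot f g = dot g f.
Proof. by apply: eq_Rintegral => x _; rewrite mulrC. Qed.

Lemma dotDl f g h : f \in Lfun2 -> g \in Lfun2 -> h \in Lfun2 ->
  dot (f \+ g) h = dot f h + dot g h.
Proof.
move=> fL2 gL2 hL2.
rewrite -RintegralD//; [|exact: integrable_dot..].
by apply: eq_Rintegral => x _; rewrite mulrDl.
Qed.

Lemma dotZl a f h : f \in Lfun2 -> h \in Lfun2 -> dot (a \*o f) h = a * dot f h.
Proof.
move=> fL2 hL2; rewrite -RintegralZl//; last exact: integrable_dot.
by apply: eq_Rintegral => x _; rewrite mulrA.
Qed.

Lemma dotNl f h : f \in Lfun2 -> h \in Lfun2 -> dot (\- f) h = - dot f h.
Proof.
move=> fL2 hL2; rewrite -mulN1r -dotZl//.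
by apply: eq_Rintegral => x _; rewrite /= mulN1r.
Qed.

Lemma dotBl f g h : f \in Lfun2 -> g \in Lfun2 -> h \in Lfun2 ->
  dot (f \- g) h = dot f h - dot g h.
Proof. by move=> fL2 gL2 hL2; rewrite dotDl ?dotNl//; exact: Lfun2N. Qed.

Lemma dotDr f g h : f \in Lfun2 -> g \in Lfun2 -> h \in Lfun2 ->
  dot h (f \+ g) = dot h f + dot h g.
Proof. by move=> *; rewrite dotC dotDl// !(dotC h). Qed.

Lemma dotZr a f h : f \in Lfun2 -> h \in Lfun2 -> dot h (a \*o f) = a * dot h f.
Proof. by move=> *; rewrite dotC dotZl// (dotC h). Qed.

Lemma dotBr f g h : f \in Lfun2 -> g \in Lfun2 -> h \in Lfun2 ->
  dot h (f \- g) = dot h f - dot h g.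
Proof. by move=> *; rewrite dotC dotBl// !(dotC h). Qed.

Lemma dot_ge0 f : 0 <= dot f f.
Proof. by apply: Rintegral_ge0 => x _; rewrite -expr2 sqr_ge0. Qed.

Lemma dot_sqrD f g t : f \in Lfun2 -> g \in Lfun2 ->
  dot (f \+ (t \*o g)) (f \+ (t \*o g)) =
  dot f f + 2 * t * dot f g + t ^+ 2 * dot g g.
Proof.
move=> fL2 gL2; have tgL2 := Lfun2Z t gL2; have ftgL2 := Lfun2D fL2 tgL2.
rewrite dotDl// !dotDr// !dotZl// !dotZr//.
by rewrite (dotC g f); ring.
Qed.

Lemma dot_cauchy_schwarz f g : f \in Lfun2 -> g \in Lfun2 ->
  dot f g ^+ 2 <= dot f f * dot g g.
Proof.
move=> fL2 gL2; apply: discriminant_le; first exact: dot_ge0.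
by move=> t; rewrite -dot_sqrD//; exact: dot_ge0.
Qed.

Lemma EFin_dot f : f \in Lfun2 -> (dot f f)%:E = (\int[mu]_x (f x ^+ 2)%:E)%E.
Proof.
move=> fL2; rewrite /dot /Rintegral fineK.
  by apply: eq_integral => x _; rewrite expr2.
exact: integrable_fin_num (integrable_dot fL2 fL2).
Qed.

Lemma Lnorm2E f : ('N[mu]_2%:E[EFin \o f] `^ 2 = \int[mu]_x (f x ^+ 2)%:E)%E.
Proof.
rewrite powR_Lnorm//; apply: eq_integral => x _ /=.
by rewrite powR_mulrn// real_normK ?num_real.
Qed.

Lemma Lfun2_sqr_integral f : measurable_fun setT f ->
  (\int[mu]_x (f x ^+ 2)%:E < +oo)%E -> f \in Lfun2.
Proof.
move=> mf; rewrite -Lnorm2E => foo.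
rewrite inE; apply/andP; split; rewrite inE//=.
exact: lty_poweRy foo.
Qed.

End dot.

(** * Completeness of the space of square-integrable functions *)

Lemma limn_einf_ge (R : realType) (u : (\bar R)^nat) (a : \bar R) :
  (\forall n \near \oo, (a <= u n)%E) -> (a <= limn_einf u)%E.
Proof.
move=> [N _ au]; rewrite limn_einf_lim; apply: lime_ge.
  exact: is_cvg_einfs.
exists N => // n /= Nn; apply: le_ereal_inf_tmp => _ [m /= nm <-].
exact/au/(leq_trans Nn).
Qed.

Lemma limn_einf_le (R : realType) (u : (\bar R)^nat) (a : \bar R) :
  (\forall n \near \oo, (u n <= a)%E) -> (limn_einf u <= a)%E.
Proof.
move=> [N _ ua]; rewrite limn_einf_lim; apply: lime_le.
  exact: is_cvg_einfs.
exists N => // n /= Nn; apply: le_trans (ua n Nn).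
by apply: ereal_inf_lbound; exists n => /=.
Qed.

Section riesz_fischer.
Context d (T : measurableType d) (R : realType).
Variable mu : {measure set T -> \bar R}.
Local Notation Lfun2 := (Lfun mu 2%:E).
Local Notation dot := (dot mu).

(** The bound on the norms makes the sum of the [4 ^+ k * v k ^+ 2] integrable,
    hence finite outside of a null set, where a convergent series has bounded
    terms.  The gap between the rates 4 and 8 is what pays for integrability. *)
Lemma ae_sqr_geometric (v : nat -> T -> R) :
  (forall k, v k \in Lfun2) -> (forall k, dot (v k) (v k) <= 8^-1 ^+ k) ->
  exists A, [/\ measurable A, mu (~` A) = 0 &
    forall x, A x -> exists M : R, forall k, `|v k x| <= M * 2^-1 ^+ k].
Proof.
move=> vL2 v8; have mv k := Lfun2_measurable (vL2 k).
pose f k x : \bar R := ((4 ^+ k) * v k x ^+ 2)%:E.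
have f0 k x : (0 <= f k x)%E by rewrite lee_fin mulr_ge0 ?sqr_ge0 ?exprn_ge0.
have mf k : measurable_fun setT (f k).
  apply/measurable_EFinP; apply: measurable_funM => //.
  exact: measurable_funX.
pose G x := (\sum_(0 <= k <oo) f k x)%E.
have mG : measurable_fun setT G.
  by apply: ge0_emeasurable_sum.
have iG : mu.-integrable setT G.
  apply/integrableP; split => //.
  under eq_integral do rewrite gee0_abs ?nneseries_ge0//.
  rewrite integral_nneseries//.
  apply: (@le_lt_trans _ _ (\sum_(0 <= k <oo) (2^-1 ^+ k)%:E)%E).
    apply: lee_nneseries => k _ //; first by rewrite integral_ge0.
    rewrite /f; under eq_integral do rewrite EFinM.
    rewrite ge0_integralZl//; last 2 first.
    - by apply/measurable_EFinP; exact: measurable_funX.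
    - by move=> x _; rewrite lee_fin sqr_ge0.
    rewrite -EFin_dot// -EFinM lee_fin (le_trans (ler_wpM2l _ (v8 k)))//.
    by rewrite -exprMn (_ : 4 * 8^-1 = 2^-1 :> R)//; lra.
  have := @cvg_geometric_series R 1 2^-1.
  rewrite ger0_norm// invf_lt1// ltr1n => /(_ isT) h.
  rewrite (_ : (fun n => \sum_(0 <= k < n) (2^-1 ^+ k)%:E)%E =
     EFin \o (series (geometric 1 2^-1))); last first.
    apply/funext => n /=; rewrite /series /= sumEFin.
    by congr EFin; apply: eq_bigr => i _; rewrite mul1r.
  by rewrite EFin_lim ?ltry//; exact: cvgP h.
have [N [mN N0 subN]] := integrable_ae measurableT iG.
exists (~` N); split; first exact: measurableC.
  by rewrite setCK.
move=> x Nx.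
have Gfin : G x \is a fin_num by apply: contrapT => h; apply/Nx/subN => /(_ I).
have G0 : (0 <= G x)%E by apply: nneseries_ge0.
exists (Num.sqrt (fine (G x))) => k.
have fG : 4 ^+ k * v k x ^+ 2 <= fine (G x).
  rewrite -lee_fin fineK//.
  by apply: (le_trans _ (@nneseries_lim_ge _ (f^~ x) xpredT 0 k.+1 _)) => //;
    rewrite big_nat_recr//= leeDr// sume_ge0.
rewrite exprVn ler_pdivlMr ?exprn_gt0//.
rewrite -[leLHS]ger0_norm; last by rewrite mulr_ge0 ?exprn_ge0.
rewrite -sqrtr_sqr ler_sqrt ?fine_ge0// (le_trans _ fG)//.
rewrite exprMn real_normK ?num_real// mulrC exprAC.
by rewrite (_ : 2 ^+ 2 = 4 :> R)//; ring.
Qed.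

(** Completeness, for sequences whose Cauchy rate is prescribed: the rate makes
    the telescoping series of increments converge almost everywhere without
    extracting a subsequence, and Fatou's lemma passes the Cauchy estimate to
    the limit. *)
Lemma riesz_fischer (u : nat -> T -> R) :
  (forall j, u j \in Lfun2) ->
  (forall i j, (j <= i)%N -> dot (u i \- u j) (u i \- u j) <= 8^-1 ^+ j) ->
  exists2 g, g \in Lfun2 &
    forall j, dot (u j \- g) (u j \- g) <= 8^-1 ^+ j.
Proof.
move=> uL2 u8; pose v k := u k.+1 \- u k.
have vL2 k : v k \in Lfun2 by exact: Lfun2B.
have [A [mA A0 vA]] := ae_sqr_geometric vL2 (fun k => u8 k.+1 k (leqnSn k)).
pose w k := (u k) \_ A.
have mw k : measurable_fun setT (w k).
  apply/(measurable_restrictT _ _).1 => //.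
  exact: measurable_funTS (Lfun2_measurable (uL2 k)).
pose g x := limn (w^~ x).
have wg x : w^~ x @ \oo --> g x.
  rewrite /g /w; have [xA|xA] := boolP (x \in A); last first.
    under eq_fun do rewrite patchE (negbTE xA).
    exact: is_cvg_cst.
  under eq_fun do rewrite patchE xA.
  have [M vM] := vA x (set_mem xA).
  have : cvgn (series (fun k => v k x)).
    apply: normed_cvg; apply: (@series_le_cvg _ _ (geometric M 2^-1)) => //=.
    - by move=> n; apply: le_trans (vM n).
    - by apply: is_cvg_geometric_series; rewrite ger0_norm// invf_lt1// ltr1n.
  rewrite (_ : (fun n => u n x) = (fun n => u 0 x + series (fun k => v k x) n)).
    by move=> vc; apply: is_cvgD => //; exact: is_cvg_cst.
  by apply/funext => n; exact: (eq_sum_telescope (u^~ x)).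
have mg : measurable_fun setT g.
  by apply: (measurable_fun_cvg mw) => x _; exact: wg.
have ug j : (\int[mu]_x ((u j x - g x) ^+ 2)%:E <= (8^-1 ^+ j)%:E)%E.
  pose h i x := ((w j x - w i x) ^+ 2)%:E.
  have mh i : measurable_fun setT (h i).
    apply/measurable_EFinP; apply: measurable_funX.
    exact: measurable_funB.
  have hg x : limn_einf (h^~ x) = ((w j x - g x) ^+ 2)%:E.
    have [-> //] : (limn_einf (h^~ x) = ((w j x - g x) ^+ 2)%:E) *
      (limn_esup (h^~ x) = ((w j x - g x) ^+ 2)%:E).
    apply: cvg_limn_einf_sup; apply: cvg_EFin; first exact: nearW.
    rewrite /h /=; under eq_fun do rewrite expr2.
    by rewrite expr2; apply: cvgM; apply: cvgB => //; exact: cvg_cst.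
  have mB (f : T -> R) : measurable_fun setT f ->
      measurable_fun setT (fun x => ((f x - g x) ^+ 2)%:E).
    move=> mf; apply/measurable_EFinP; apply: measurable_funX.
    exact: measurable_funB.
  (* The truncations [w] converge everywhere, and truncating only lowers the
     squared differences. *)
  rewrite (@ae_eq_integral _ _ _ mu setT (fun x => limn_einf (h^~ x)))//.
  - apply: le_trans (fatou _ _ _ _) _ => //.
      by move=> i x _; rewrite lee_fin sqr_ge0.
    apply: limn_einf_le; exists j => // i /= ij.
    rewrite (le_trans _ (_ : (dot (u i \- u j) (u i \- u j))%:E <= _)%E)//.
      rewrite EFin_dot; last exact: Lfun2B.
      apply: ge0_le_integral => //.
      + by move=> x _; rewrite lee_fin sqr_ge0.
      + apply/measurable_EFinP; apply: measurable_funX.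
        by apply: measurable_funB; exact: Lfun2_measurable.
      + move=> x _; rewrite lee_fin /w !patchE -sqrrN opprB.
        by case: ifPn => // _; rewrite subr0 expr0n sqr_ge0.
    by rewrite lee_fin; exact: u8.
  - exact/mB/Lfun2_measurable.
  - by under eq_fun do rewrite hg; exact: mB.
  - exists (~` A); split; [exact: measurableC|exact: A0|].
    move=> x /= nx Ax; apply: nx => _.
    by rewrite hg /w patchE mem_set.
have ugL2 j : u j \- g \in Lfun2.
  apply: Lfun2_sqr_integral; last exact: le_lt_trans (ug j) (ltry _).
  by apply: measurable_funB => //; exact: Lfun2_measurable.
exists g => [|j].
  rewrite (_ : g = u 0 \- (u 0 \- g)); first exact: Lfun2B.
  by apply/funext => x /=; rewrite subKr.
by rewrite -lee_fin EFin_dot//; exact: ug.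
Qed.

End riesz_fischer.

(** * Riesz representation on a subspace *)

Lemma le_geometric (R : realType) (x y K : R) :
  (forall j : nat, x <= y + 8^-1 ^+ j * K) -> x <= y.
Proof.
move=> xy; have : (fun j => y + 8^-1 ^+ j * K) @ \oo --> y + 0 * K.
  apply: cvgD; first exact: cvg_cst.
  apply: cvgM; last exact: cvg_cst.
  by apply: cvg_expr; rewrite ger0_norm// invf_lt1// ltr1n.
rewrite mul0r addr0 => h; rewrite -(cvg_lim _ h)//.
by apply: limr_ge; [exact: cvgP h|exact: nearW].
Qed.

Section riesz_subspace.
Context d (T : measurableType d) (R : realType).
Variable mu : {measure set T -> \bar R}.
Local Notation Lfun2 := (Lfun mu 2%:E).
Local Notation dot := (dot mu).

(** The form is represented by an element of the closure of [S], obtained as the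
    limit of a minimising sequence of [J f = |f|^2 - 2 Lam f].  Since
    [J (u j + t f)] is a quadratic polynomial in [t] that stays above the
    infimum [m], its discriminant bounds the defect [dot (u j) f - Lam f] by how
    far [J (u j)] is from [m]. *)
Lemma riesz_subspace (S : set (T -> R)) (Lam : (T -> R) -> R) (C : R) :
  0 <= C -> S (cst 0) -> (forall f, S f -> f \in Lfun2) ->
  (forall f g t, S f -> S g -> S (f \+ (t \*o g))) ->
  (forall f g t, S f -> S g -> Lam (f \+ (t \*o g)) = Lam f + t * Lam g) ->
  (forall f, S f -> Lam f ^+ 2 <= C * dot f f) ->
  exists2 g, g \in Lfun2 & dot g g <= C /\ forall f, S f -> Lam f = dot g f.
Proof.
move=> C0 S0 SL2 SD LD LC.
pose J f := dot f f - 2 * Lam f.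
(* [J f] is at least [N - 2 * sqrt (C * N)] for [N = dot f f], hence at least
   [- C]. *)
have JC f : S f -> - C <= J f.
  move=> Sf; have := LC f Sf; have := dot_ge0 mu f; rewrite /J.
  move: (dot f f) (Lam f) => N L N0 LN.
  suff : L <= (N + C) / 2 by lra.
  have NC : 0 <= (N + C) / 2 by lra.
  have [L0|L0] := leP L 0; first exact: le_trans NC.
  rewrite -(@ler_pXn2r _ 2)// ?nnegrE ?(ltW L0)//.
  apply: le_trans LN _; rewrite -subr_ge0.
  by rewrite (_ : _ - _ = ((N - C) / 2) ^+ 2) ?sqr_ge0//; field.
pose m := inf (J @` S).
have hinf : has_inf (J @` S).
  split; first by exists (J (cst 0)); exists (cst 0).
  by exists (- C) => _ [f Sf <-]; exact: JC.
have mJ f : S f -> m <= J f.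
  by move=> Sf; apply: ge_inf; [exact: hinf.2|exists f].
(* The factor 1/4 is what turns the defects of [u i] and [u j] into a Cauchy
   estimate at the exact rate that completeness asks for. *)
pose dl (j : nat) : R := 8^-1 ^+ j / 4.
have dl0 j : 0 < dl j by rewrite divr_gt0// exprn_gt0// invr_gt0.
have /choice[u uP] : forall j, exists f, S f /\ J f < m + dl j.
  move=> j; have [_ [f Sf <-] Jf] := inf_adherent (dl0 j) hinf.
  by exists f.
have Su j : S (u j) := (uP j).1.
have Ju j : J (u j) < m + dl j := (uP j).2.
have uL2 j := SL2 _ (Su j).
have JD f g t : S f -> S g ->
    J (f \+ (t \*o g)) = J f + 2 * t * (dot f g - Lam g) + t ^+ 2 * dot g g.
  move=> Sf Sg; rewrite /J dot_sqrD ?LD//; [ring|exact: SL2..].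
have uB i j : S (u i \- u j).
  rewrite (_ : _ \- _ = u i \+ (-1 \*o u j)); first exact: SD.
  by apply/funext => x /=; rewrite mulN1r.
(* The midpoint of [u i] and [u j] lies in [S], so [m] bounds [J] there; this
   is the parallelogram identity, read off the quadratic expansion [JD]. *)
have ucauchy i j : (j <= i)%N -> dot (u i \- u j) (u i \- u j) <= 8^-1 ^+ j.
  move=> ji; have h1 := mJ _ (SD _ _ (2^-1) (Su j) (uB i j)).
  have h2 : J (u i) = J (u j \+ (1 \*o (u i \- u j))).
    by congr J; apply/funext => x /=; rewrite mul1r addrC subrK.
  rewrite !JD// in h1 h2.
  have := Ju i; have := Ju j.
  have : dl i <= dl j.
    rewrite ler_pM2r ?invr_gt0// ler_wiXn2l// ?invr_ge0// invf_le1//.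
    by rewrite ler1n.
  rewrite /dl; move: h1 h2; move: (dot _ _) => N; move: (_ - Lam _) => z.
  by lra.
have [g gL2 ug] := riesz_fischer uL2 ucauchy.
have gE f : S f -> Lam f = dot g f.
  move=> Sf; have fL2 := SL2 _ Sf.
  apply/eqP; rewrite -subr_eq0 -sqrf_eq0 eq_le sqr_ge0 andbT.
  apply: (@le_geometric _ _ _ (4 * dot f f)) => j; rewrite add0r.
  have h1 : (dot (u j) f - Lam f) ^+ 2 <= dl j * dot f f.
    apply: discriminant_le; first exact: dot_ge0.
    move=> t; have := mJ _ (SD _ _ t (Su j) Sf); rewrite JD//.
    by have := Ju j; lra.
  have h2 : (dot (u j) f - dot g f) ^+ 2 <= 8^-1 ^+ j * dot f f.
    rewrite -dotBl//; apply: le_trans (dot_cauchy_schwarz _ _) _ => //.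
      exact: Lfun2B.
    by apply: ler_wpM2r => //; exact: dot_ge0.
  move: h1 h2; rewrite /dl; have := dot_ge0 mu f.
  have : 0 < 8^-1 ^+ j :> R by rewrite exprn_gt0// invr_gt0.
  move: (8^-1 ^+ j) (dot f f) (dot (u j) f) (dot g f) (Lam f) => e N a b c.
  move=> /ltW e0 N0 h1 h2; have := mulr_ge0 e0 N0.
  by have := sqr_ge0 (2 * a - b - c); lra.
exists g => //; split => //.
(* As [g] represents [Lam], [dot g g] is [|u j - g|^2 - J (u j)]. *)
apply: (@le_geometric _ _ _ 1) => j; rewrite mulr1.
have := JC _ (Su j); have := ug j.
rewrite dotBl ?dotBr//; last exact: Lfun2B.
by rewrite /J gE// (dotC mu (u j) g); lra.
Qed.

End riesz_subspace.

(** * Smooth functions on the line *)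

Section smooth.
Context {R : realType}.
Implicit Types (f g : R -> R) (p q : {poly R}).

Definition smooth f := forall k x, derivable (derive1n k f) x 1.

(** Smoothness is best proved by coinduction: a class of differentiable
    functions that is stable under derivation contains only smooth functions.
    Sums, products, affine substitutions and the flat functions are all handled
    in this way. *)
Lemma smooth_coind (P : set (R -> R)) :
  (forall f, P f -> (forall x, derivable f x 1) /\ P (derive1 f)) ->
  forall f, P f -> smooth f.
Proof.
move=> Pd f Pf k; elim: k f Pf => [|k IH] f Pf x.
  by have [+ _] := Pd _ Pf.
by rewrite derive1Sn; apply: IH; have [] := Pd _ Pf.
Qed.

Lemma smooth_derivable f x : smooth f -> derivable f x 1.
Proof. by move=> /(_ 0%N x). Qed.

Lemma smooth_derive1 f : smooth f -> smooth (derive1 f).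
Proof. by move=> sf k x; rewrite -derive1Sn; exact: sf. Qed.

(** The derivative of a product of two smooth functions is a sum of products:
    products alone are not stable under derivation, the algebra generated by the
    smooth functions is. *)
Inductive smooth_alg : (R -> R) -> Prop :=
| smooth_alg_smooth f : smooth f -> smooth_alg f
| smooth_algD f g : smooth_alg f -> smooth_alg g -> smooth_alg (f \+ g)
| smooth_algM f g : smooth_alg f -> smooth_alg g -> smooth_alg (f \* g).

Lemma smooth_algP f : smooth_alg f -> smooth f.
Proof.
apply: smooth_coind => {}f; elim => {f}.
- move=> f sf; split; first exact: (sf 0%N).
  by apply: smooth_alg_smooth; exact: smooth_derive1.
- move=> f g _ [df sf] _ [dg sg]; split=> [x|]; first exact: derivableD.
  rewrite (_ : derive1 _ = derive1 f \+ derive1 g).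
    exact: smooth_algD.
  by apply/funext => x; rewrite derive1E deriveD// -!derive1E.
- move=> f g af [df sf] ag [dg sg]; split=> [x|]; first exact: derivableM.
  rewrite (_ : derive1 _ = (f \* (derive1 g)) \+ (g \* (derive1 f))).
    by apply: smooth_algD; exact: smooth_algM.
  by apply/funext => x; rewrite derive1E deriveM// -!derive1E.
Qed.

Lemma smoothD f g : smooth f -> smooth g -> smooth (f \+ g).
Proof.
by move=> sf sg; apply/smooth_algP/smooth_algD; exact: smooth_alg_smooth.
Qed.

Lemma smoothM f g : smooth f -> smooth g -> smooth (f \* g).
Proof.
by move=> sf sg; apply/smooth_algP/smooth_algM; exact: smooth_alg_smooth.
Qed.

Lemma smooth_cst c : smooth (cst c).
Proof.
apply: (@smooth_coind (range (fun c : R => cst c : R -> R))); last by exists c.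
move=> _ [a _ <-]; split=> //; exists 0 => //.
by apply/funext => x; rewrite derive1_cst.
Qed.

Lemma smooth_affine a b f : smooth f -> smooth (fun x => f (a * x + b)).
Proof.
move=> sf; apply: (@smooth_coind
    [set g | exists c h, smooth h /\ g = fun x => c * h (a * x + b)]).
  move=> _ [c [h [sh ->]]].
  have dh (x : R) : is_derive x 1 (fun x => c * h (a * x + b))
      (c * a * (derive1 h) (a * x + b)).
    have hd : is_derive (a * x + b) 1 h ((derive1 h) (a * x + b)).
      by rewrite derive1E; apply/derivableP/smooth_derivable.
    have ad : is_derive x 1 (fun x => a * x + b) a.
      have -> : (fun x => a * x + b) = (a \*: (@id R)) + cst b by [].
      by apply: is_derive_eq; rewrite /GRing.scale/= mulr1 addr0.
    have := @is_deriveZ _ _ _ _ c x 1 _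
      (@is_derive1_comp _ h (fun x => a * x + b) x _ _ hd ad).
    by move/is_derive_eq; apply; rewrite /GRing.scale/= mulrAC mulrA.
  split=> [x|]; first by have [] := dh x.
  exists (c * a), (derive1 h); split; first exact: smooth_derive1.
  by apply/funext => x; rewrite derive1E derive_val.
by exists 1, f; split=> //; apply/funext => x; rewrite mul1r.
Qed.

(** The functions [p (1/x) exp (-1/x)], extended by 0 to the left of the origin.
    The polynomial [p] is there because a derivative of [exp (-1/x)] is again of
    this form, for another polynomial. *)
Definition flat p (x : R) : R := if 0 < x then p.[x^-1] * expR (- x^-1) else 0.

(** Each monomial [t ^+ i] is at most [i`! * expR t]: compare it with the term
    of degree [i] of the exponential series. *)
Lemma horner_le_expR p : exists2 K, 0 <= K &
  forall t, 0 <= t -> `|p.[t]| <= K * expR t.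
Proof.
exists (\sum_(i < size p) `|p`_i| * i`!%:R).
  by apply: sumr_ge0 => i _; rewrite mulr_ge0.
move=> t t0; rewrite horner_coef; apply: le_trans (ler_norm_sum _ _ _) _.
rewrite mulr_suml; apply: ler_sum => i _.
rewrite normrM -mulrA ler_wpM2l// normrX ger0_norm//.
case: (i : nat) => [|n].
  by rewrite expr0 fact0 mul1r; have := expR_ge1Dx t; lra.
have := expR_ge1Dxn n t0; rewrite addrC -lerBrDr.
move=> h; rewrite mulrC -ler_pdivrMr ?ltr0n ?fact_gt0//.
by apply: le_trans h _; rewrite gerBl.
Qed.

(** Flatness at the origin, from the domination of [t ^+ 2 * p (t)] by [exp t]
    at [t = 1/x].  A quadratic bound suffices to get a zero derivative there. *)
Lemma flat_le p : exists2 K, 0 <= K & forall x, `|flat p x| <= K * x ^+ 2.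
Proof.
have [K K0 pK] := horner_le_expR (p * 'X ^+ 2); exists K => // x.
rewrite /flat; case: ltP => x0; last by rewrite normr0 mulr_ge0// sqr_ge0.
have := pK x^-1; rewrite invr_ge0 (ltW x0) => /(_ isT).
rewrite hornerM hornerXn normrM normrX [`|x^-1|]ger0_norm; last first.
  by rewrite invr_ge0 ltW.
move=> h; rewrite normrM [X in _ * X]gtr0_norm ?expR_gt0// expRN.
rewrite ler_pdivrMr ?expR_gt0// mulrAC -ler_pdivrMr ?exprn_gt0//.
by rewrite -exprVn.
Qed.

Lemma is_derive_flat p (x : R) :
  is_derive x 1 (flat p) (flat ('X ^+ 2 * (p - p^`()))  x).
Proof.
have [x0|x0|->] := ltgtP x 0.
- rewrite {2}/flat ltNge (ltW x0)/=.
  apply: (@near_eq_is_derive _ _ _ (cst 0)).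
  by near=> y; rewrite /flat ltNge ltW//; near: y; exact: lt_nbhsl.
- rewrite {2}/flat x0.
  suff : is_derive x 1 ((horner p \o GRing.inv) * (expR \o (- GRing.inv)))
      (('X ^+ 2 * (p - p^`())).[x^-1] * expR (- x^-1)).
    apply: near_eq_is_derive.
    by near=> y; rewrite /flat (_ : 0 < y)//; near: y; exact: lt_nbhsr.
  have dV : is_derive x 1 (fun x : R => x^-1) (- x ^- 2).
    have := @is_deriveV _ id x 1 1 (lt0r_neq0 x0) (is_derive_id x 1).
    by move/is_derive_eq; apply; rewrite /GRing.scale/= mulr1.
  have dp := @is_derive1_comp _ (horner p) _ x _ _ (is_derive_poly p x^-1) dV.
  have de := @is_derive1_comp _ expR _ x _ _ (is_derive_expR (- x^-1))
    (is_deriveN dV).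
  have := is_deriveM dp de.
  move/is_derive_eq; apply.
  rewrite /GRing.scale /= hornerM hornerXn hornerD hornerN -exprVn; ring.
- rewrite {2}/flat ltxx.
  have [K K0 pK] := flat_le p.
  have fd : h^-1 *: ((flat p \o shift 0) (h *: (1 : R)) - flat p 0)
      @[h --> 0^'] --> (0 : R).
    apply/cvgr0Pnorm_le => e e0.
    have eK : 0 < e / (K + 1) by rewrite divr_gt0// ltr_wpDl.
    near=> h.
    have h0 : h != 0 by near: h; exact: nbhs_dnbhs_neq.
    have he : `|h| <= e / (K + 1).
      by near: h; apply: dnbhs0_le.
    rewrite /= addr0 {2}/flat ltxx subr0 /GRing.scale/= mulr1 normrM normfV.
    rewrite ler_pdivrMl ?normr_gt0//; apply: le_trans (pK h) _.
    rewrite -real_normK ?num_real// expr2 mulrCA ler_wpM2l//.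
    move: he; rewrite ler_pdivlMr; last by rewrite ltr_wpDl.
    by apply: le_trans; rewrite mulrC ler_wpM2l// lerDl.
  by apply: DeriveDef; [exact: cvgP fd|exact: cvg_lim fd].
Unshelve. all: by end_near. Qed.

Lemma smooth_flat p : smooth (flat p).
Proof.
apply: (@smooth_coind (range flat)); last by exists p.
move=> _ [q _ <-]; split=> [x|]; first by have [] := is_derive_flat q x.
exists ('X ^+ 2 * (q - q^`())) => //.
by apply/funext => x; rewrite derive1E; have [_ ->] := is_derive_flat q x.
Qed.

End smooth.

(** * Test functions *)

Section test_functions.
Context {R : realType}.
Implicit Types (A K : set R) (f g phi : R -> R).
Local Notation mu := (@lebesgue_measure R).

(** The support need not be computed: any compact set containing the points
    where the function is nonzero contains the support. *)
Lemma test_functions_intro A K phi : compact K -> K `<=` A ->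
  [set x | phi x != 0] `<=` K -> smooth phi -> test_functions A phi.
Proof.
move=> cK KA sK sphi; split=> //.
have clK : closed K by apply: compact_closed => //; exact: Rhausdorff.
have cs : closure [set x | phi x != 0] `<=` K.
  by rewrite closureE; exact: smallest_sub.
split; last exact: subset_trans KA.
by apply: subclosed_compact cs => //; exact: closed_closure.
Qed.

Lemma test_functions_smooth A phi : test_functions A phi -> smooth phi.
Proof. by case. Qed.

Lemma test_functions_cst0 A : test_functions A (cst 0).
Proof.
apply: (@test_functions_intro A set0) => //.
- exact: compact0.
- by move=> x /=; rewrite eqxx.
- exact: smooth_cst.
Qed.

Lemma test_functions_lin A f g t : test_functions A f -> test_functions A g ->
  test_functions A (f \+ (t \*o g)).
Proof.
move=> [sf [cf fA]] [sg [cg gA]].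
apply: (@test_functions_intro A
  (closure [set x | f x != 0] `|` closure [set x | g x != 0])).
- exact: compactU.
- by rewrite subUset.
- move=> x /= fg; have [fx|fx] := eqVneq (f x) 0; last first.
    by left; exact: subset_closure.
  right; apply: subset_closure => /=; apply: contra_neq fg => gx.
  by rewrite fx gx mulr0 addr0.
- by apply: smoothD => //; apply: smoothM => //; exact: smooth_cst.
Qed.

(** Outside of the support, [phi] vanishes on a neighbourhood, and so does its
    derivative: the support does not grow. *)
Lemma test_functions_derive1 A phi :
  test_functions A phi -> test_functions A (derive1 phi).
Proof.
move=> [sphi [cphi phiA]].
apply: (test_functions_intro cphi) => //; last exact: smooth_derive1.
move=> x /=; apply: contra_neqP => nx.
have nearx : \near x, cst 0 x = phi x.
  have : nbhs x (~` closure [set x | phi x != 0]).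
    by apply: open_nbhs_nbhs; split=> //; exact/closed_openC/closed_closure.
  apply: filterS => y ny /=; apply/esym/eqP/negP => py.
  by apply: ny; apply: subset_closure; apply/negP.
rewrite derive1E -(near_eq_derive _ nearx).
exact: derive_cst.
Qed.

Lemma test_functions_out A phi x : test_functions A phi -> ~ A x -> phi x = 0.
Proof.
move=> [_ [_ phiA]] Ax; apply/eqP/negP => px; apply/Ax/phiA/subset_closure.
exact/negP.
Qed.

Lemma smooth_continuous f : smooth f -> continuous f.
Proof.
move=> sf x; apply: differentiable_continuous.
exact/derivable1_diffP/smooth_derivable.
Qed.

(** Test functions increasing to the indicator of ]a, b[ as [j] grows.
    Dilating the flat function is enough, since [exp (-1/(j x))] tends to 1 for
    every positive [x]. *)
Definition itv_bump a b (j : nat) (x : R) : R :=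
  flat 1 (j.+1%:R * (x - a)) * flat 1 (j.+1%:R * (b - x)).

Lemma flat1_le1 (x : R) : 0 <= flat 1 x <= 1.
Proof.
rewrite /flat hornerE mul1r; case: ifPn => [x0|_]; last by rewrite lexx ler01.
by rewrite expR_ge0 expR_le1 oppr_le0 invr_ge0 ltW.
Qed.

Lemma itv_bump_le1 a b j (x : R) : 0 <= itv_bump a b j x <= 1.
Proof.
have /andP[u0 u1] := flat1_le1 (j.+1%:R * (x - a)).
have /andP[v0 v1] := flat1_le1 (j.+1%:R * (b - x)).
by rewrite /itv_bump mulr_ge0// mulr_ile1.
Qed.

Lemma itv_bump_out a b j (x : R) : ~ `]a, b[%classic x -> itv_bump a b j x = 0.
Proof.
rewrite /= in_itv/= => /negP; rewrite negb_and -!leNgt => /orP[xa|bx].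
  rewrite /itv_bump {1}/flat ltNge (_ : _ * _ <= 0) ?mul0r//.
  by rewrite pmulr_rle0// subr_le0.
rewrite /itv_bump {2}/flat ltNge (_ : _ * _ <= 0) ?mulr0//.
by rewrite pmulr_rle0// subr_le0.
Qed.

Lemma test_functions_itv_bump A a b j : `[a, b] `<=` A ->
  test_functions A (itv_bump a b j).
Proof.
move=> abA; apply: (test_functions_intro _ abA).
- exact: segment_compact.
- move=> x /=; apply: contra_neqP => xab; apply: itv_bump_out => xab'.
  by apply: xab; exact: subset_itv_oo_cc xab'.
- apply: smoothM.
    rewrite (_ : (fun _ => _) =
      fun x => flat 1 (j.+1%:R * x + (- (j.+1%:R * a)))).
      exact/smooth_affine/smooth_flat.
    by apply/funext => x; rewrite mulrBr.
  rewrite (_ : (fun _ => _) =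
    fun x => flat 1 (- j.+1%:R * x + j.+1%:R * b)).
    exact/smooth_affine/smooth_flat.
  by apply/funext => x; rewrite mulrBr mulNr addrC.
Qed.

Lemma flat1_cvg (x : R) : 0 < x ->
  flat 1 (j.+1%:R * x) @[j --> \oo] --> (1 : R).
Proof.
move=> x0; rewrite /flat.
under eq_fun do rewrite hornerE mul1r pmulr_lgt0// ltr0n/=.
suff : (- (j.+1%:R * x)^-1) @[j --> \oo] --> (0 : R).
  by move/(cvg_comp _ _)/(_ (@continuous_expR R 0)); rewrite expR0.
under eq_fun do rewrite invfM -mulrN.
rewrite -(mul0r (- x^-1)); apply: cvgM; last exact: cvg_cst.
exact: cvg_harmonic.
Qed.

Lemma itv_bump_cvg a b (x : R) :
  itv_bump a b j x @[j --> \oo] --> (\1_`]a, b[%classic x : R).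
Proof.
have [xab|xab] := boolP (x \in `]a, b[%classic); last first.
  rewrite indicE (negbTE xab).
  rewrite notin_setE in xab; under eq_fun do rewrite itv_bump_out//.
  exact: cvg_cst.
rewrite indicE xab -(mulr1 (true%:R : R)) /itv_bump.
move: xab; rewrite inE/= in_itv/= => /andP[ax xb].
by apply: cvgM; apply: flat1_cvg; rewrite subr_gt0.
Qed.

End test_functions.

(** * The fundamental lemma of the calculus of variations *)

Section fundamental_lemma.
Context {R : realType}.
Local Notation mu := (@lebesgue_measure R).

Lemma locally_integrable_itv (A : set R) (h : R -> R) c d :
  locally_integrable A h -> `[c, d] `<=` A ->
  mu.-integrable `[c, d] (EFin \o h).
Proof.
move=> [mh oA hK] cdA; apply/integrableP; split.
  apply/measurable_EFinP; apply: measurable_funS cdA mh.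
  exact: open_measurable.
apply: hK => //; exact: segment_compact.
Qed.

(** Test against [itv_bump a b j] and let [j] go to infinity; the modulus of [h]
    dominates, and is integrable on the compact interval [a, b]. *)
Lemma locally_integrable_itv_eq0 (A : set R) (h : R -> R) (a b : R) :
  locally_integrable A h ->
  (forall phi, test_functions A phi ->
    \int[mu]_(x in A) (h x * phi x) = 0) ->
  `[a, b] `<=` A -> \int[mu]_(x in `]a, b[) h x = 0.
Proof.
move=> lh h0 abA; have ih := locally_integrable_itv lh abA.
have ih' : mu.-integrable `]a, b[ (EFin \o h).
  by apply: integrableS ih => //; exact: subset_itv_oo_cc.
have mh := measurable_int _ ih'.
have abA' : `]a, b[ `<=` A by apply: subset_trans abA; exact: subset_itv_oo_cc.
have mb j : measurable_fun `]a, b[ (fun x => (h x * itv_bump a b j x)%:E).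
  apply/measurable_EFinP; apply: measurable_funM; first exact/measurable_EFinP.
  apply: measurable_funTS; apply: continuous_measurable_fun.
  apply: smooth_continuous.
  exact: test_functions_smooth (test_functions_itv_bump j abA).
have hb j x : (`|(h x * itv_bump a b j x)%:E| <= `|(h x)%:E|)%E.
  have /andP[b0 b1] := itv_bump_le1 a b j x.
  by rewrite lee_fin normrM ler_piMr// ger0_norm.
have e j : (\int[mu]_(x in `]a, b[) (h x * itv_bump a b j x)%:E = 0)%E.
  rewrite -[LHS]fineK; last first.
    apply: integrable_fin_num => //.
    by apply: le_integrable ih' => //; exact: mb.
  suff : \int[mu]_(x in `]a, b[) (h x * itv_bump a b j x) = 0.
    by rewrite /Rintegral => ->.
  rewrite -[RHS](h0 _ (test_functions_itv_bump j abA)).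
  rewrite Rintegral_mkcond [RHS]Rintegral_mkcond; apply: eq_Rintegral => x _.
  rewrite !patchE; case: ifPn => xab.
    by rewrite ifT// inE; apply: abA'; rewrite inE in xab.
  case: ifPn => // _; rewrite notin_setE in xab.
  by rewrite itv_bump_out ?mulr0.
have [_ _] : [/\ mu.-integrable `]a, b[ (EFin \o h),
    (\int[mu]_(x in `]a, b[) `|(h x * itv_bump a b j x)%:E - (h x)%:E|)%E
      @[j --> \oo] --> 0%E &
    (\int[mu]_(x in `]a, b[) (h x * itv_bump a b j x)%:E)%E @[j --> \oo] -->
      (\int[mu]_(x in `]a, b[) (h x)%:E)%E].
  apply: (@dominated_convergence _ _ _ mu `]a, b[ (measurable_itv _)
    (fun j x => (h x * itv_bump a b j x)%:E) (EFin \o h) (abse \o (EFin \o h))).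
  - exact: mb.
  - exact: mh.
  - apply/aeW => x xab; apply: cvg_EFin; first exact: nearW.
    rewrite /= -[X in _ --> X]mulr1; apply: cvgM; first exact: cvg_cst.
    have : itv_bump a b j x @[j --> \oo] --> (\1_`]a, b[%classic x : R).
      exact: itv_bump_cvg.
    by rewrite indicE mem_set.
  - exact: integrable_abse.
  - by apply/aeW => x j _; exact: hb.
rewrite (_ : (fun j => _) = cst 0%E); last exact/funext/e.
by move=> /cvg_lim; rewrite lim_cst// /Rintegral => <-.
Qed.

(** All the primitives of [h] over subintervals vanish, and by Lebesgue's
    differentiation theorem [h] is almost everywhere the derivative of its
    primitive. *)
Lemma locally_integrable_ae0_itv (A : set R) (h : R -> R) (c d : R) :
  locally_integrable A h ->
  (forall phi, test_functions A phi ->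
    \int[mu]_(x in A) (h x * phi x) = 0) ->
  `[c, d] `<=` A -> {ae mu, forall x, `]c, d[%classic x -> h x = 0}.
Proof.
move=> lh h0 cdA; have ih := locally_integrable_itv lh cdA.
pose H := h \_ `[c, d].
have iH (D : set R) : measurable D -> mu.-integrable D (EFin \o H).
  move=> mD; rewrite /H -restrict_EFin; apply/integrable_restrict => //.
  by apply: integrableS ih => //; exact: measurableI.
have lH : locally_integrable setT H.
  by apply: open_integrable_locally; [exact: openT|exact: iH].
have := @FTC1 R H (BLeft c) (fun y => iH _ (measurable_itv _)) lH.
apply: filterS; first exact: (ae_filter_ringOfSetsType mu).
move=> x /= hx; rewrite in_itv/= => /andP[cx xd].
have [_] : derivable _ x 1 /\ _ := hx cx.
rewrite {2}/H patchE mem_set; last by rewrite /= in_itv/= !ltW.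
move=> <-; rewrite derive1E.
rewrite (@near_eq_derive _ _ _ _ (cst 0)); first exact: derive_cst.
near=> y.
have cy : c < y by near: y; exact: lt_nbhsr.
have yd : y < d by near: y; exact: lt_nbhsl.
rewrite -Rintegral_itv_bndo_bndc; last exact: iH.
rewrite -Rintegral_itv_obnd_cbnd; last exact: iH.
transitivity (\int[mu]_(x in `]c, y[) h x).
  apply: eq_Rintegral => z; rewrite inE/= in_itv/= => /andP[cz zy].
  by rewrite /H patchE mem_set//= in_itv/= (ltW cz) (ltW (lt_trans zy yd)).
apply: locally_integrable_itv_eq0 lh h0 _.
by apply: subset_trans cdA; apply: subset_itvl; rewrite bnd_simp ltW.
Unshelve. all: by end_near. Qed.

(** Exhaust ]l, r[ by countably many compactly included intervals, so that the
    exceptional sets still have a null union. *)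
Lemma locally_integrable_ae0 (l r : R) (h : R -> R) :
  locally_integrable `]l, r[ h ->
  (forall phi, test_functions `]l, r[ phi ->
    \int[mu]_(x in `]l, r[) (h x * phi x) = 0) ->
  {ae mu, forall x, `]l, r[%classic x -> h x = 0}.
Proof.
move=> lh h0.
have H n : {ae mu, forall x,
    `]l + n.+1%:R^-1, r - n.+1%:R^-1[%classic x -> h x = 0}.
  apply: locally_integrable_ae0_itv lh h0 _ => x /=.
  rewrite !in_itv/= => /andP[lx xr].
  rewrite (lt_le_trans _ lx) ?ltrDl//=.
  by rewrite (le_lt_trans xr)// gtrBl.
have := ae_foralln H.
apply: filterS => x hx /=; rewrite in_itv/= => /andP[lx xr].
have m0 : 0 < Num.min (x - l) (r - x) by rewrite lt_min !subr_gt0 lx.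
near \oo => n; apply: (hx n) => /=.
have : n.+1%:R^-1 < Num.min (x - l) (r - x).
  by near: n; exact: (near_infty_natSinv_lt (PosNum m0)).
rewrite lt_min in_itv/= => /andP[]; rewrite ltrBrDl => -> /=.
by rewrite ltrBrDr ltrBrDl addrC.
Unshelve. all: by end_near. Qed.

End fundamental_lemma.

(** * The discrete energy against a test function *)

(** For [w = n] the first factor is a discrete energy, and the second one a
    Riemann sum of mesh [1/n]. *)
Lemma sum_cauchy_schwarz (R : realFieldType) (I : Type) (r : seq I) (w : R)
  (a b : I -> R) : 0 < w ->
  (\sum_(i <- r) a i * b i) ^+ 2 <=
  (\sum_(i <- r) w * a i ^+ 2) * (\sum_(i <- r) b i ^+ 2 / w).
Proof.
move=> w0; apply: discriminant_le.
  by apply: sumr_ge0 => i _; rewrite divr_ge0 ?sqr_ge0 ?ltW.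
move=> t.
rewrite (_ : _ + _ = \sum_(i <- r) w * (a i + t * (b i / w)) ^+ 2).
  by apply: sumr_ge0 => i _; rewrite mulr_ge0 ?sqr_ge0 ?ltW.
rewrite !mulr_sumr -!big_split/=; apply: eq_bigr => i _.
by field; rewrite gt_eqF.
Qed.

Lemma summation_by_parts (R : comPzRingType) (c p : nat -> R) (m : nat) :
  \sum_(k < m.+1) c k * (p k.+1 - p k) =
  c m * p m.+1 - c 0 * p 0 - \sum_(k < m) (c k.+1 - c k) * p k.+1.
Proof.
elim: m => [|m IH]; first by rewrite big_ord1 big_ord0 subr0 mulrBr.
by rewrite big_ord_recr/= IH [in RHS]big_ord_recr/=; ring.
Qed.

Section discrete.
Context {R : realType}.
Implicit Types (g h phi : R -> R) (n k m : nat).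
Local Notation mu := (@lebesgue_measure R).
Local Notation Lfun2 := (Lfun mu 2%:E).
Local Notation dot := (dot mu).

Definition cell n k : set R := `[k%:R / n%:R, k.+1%:R / n%:R[%classic.

Lemma step_functions_cell n g k x :
  step_functions n g -> (k < n)%N -> cell n k x -> g x = g (k%:R / n%:R).
Proof.
move=> [gk gn]; case: n gk gn => // n gk gn; rewrite ltnS leq_eqVlt.
have n0 : 0 < n.+1%:R :> R by rewrite ltr0n.
move=> /predU1P[->|kn] xk.
  apply: gn => /=.
    move: xk; rewrite /cell/= !in_itv/= divff ?gt_eqF// => /andP[-> xn].
    by rewrite ltW.
  by rewrite in_itv/= lexx/= ler_pdivrMr// mul1r ler_nat.
apply: (gk k) => //=.
by rewrite in_itv/= lexx/= ltr_pM2r ?invr_gt0// ltr_nat.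
Qed.

Lemma itv_cellS n m : (0 < n)%N ->
  `[0, m.+1%:R / n%:R[%classic = `[0, m%:R / n%:R[ `|` cell n m.
Proof.
move=> n0; rewrite /cell; apply: itv_bndbnd_setU; rewrite bnd_simp.
  by rewrite divr_ge0.
by rewrite ler_pM2r ?invr_gt0 ?ltr0n// ler_nat.
Qed.

Lemma step_functions_measurable n g : (0 < n)%N -> step_functions n g ->
  measurable_fun (`[0, 1]%classic : set R) g.
Proof.
move=> n0 sg.
have mcst (D : set R) c :
    measurable D -> (forall x, D x -> g x = c) -> measurable_fun D g.
  move=> mD gc; apply: (eq_measurable_fun (cst c)) => //.
  by move=> x; rewrite inE => /gc.
have H m : (m <= n)%N -> measurable_fun (`[0, m%:R / n%:R[%classic : set R) g.
  elim: m => [_|m IH mn].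
    by rewrite mul0r set_itvco0; exact: measurable_fun_set0.
  rewrite itv_cellS//; apply/measurable_funU; [exact: measurable_itv..|split].
    by apply: IH; exact: ltnW.
  apply: (mcst _ (g (m%:R / n%:R))) => [|x]; first exact: measurable_itv.
    exact: step_functions_cell.
have := H n (leqnn _); rewrite divff ?pnatr_eq0 -?lt0n// => H1.
rewrite (@itv_bndbnd_setU _ _ _ (BLeft 1)) ?bnd_simp//.
apply/measurable_funU; [exact: measurable_itv..|split=> //].
apply: (mcst _ (g 1)) => // x /=.
by rewrite in_itv/= => /andP[x1 x1']; congr g; apply/le_anti; rewrite x1 x1'.
Qed.

Lemma Rintegral_cells h n m : (0 < n)%N -> mu.-integrable setT (EFin \o h) ->
  \int[mu]_(x in `[0%R, (m%:R / n%:R)%R[) h x =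
  \sum_(k < m) \int[mu]_(x in cell n k) h x.
Proof.
move=> n0 ih; elim: m => [|m IH].
  by rewrite mul0r set_itvco0 Rintegral_set0 big_ord0.
rewrite big_ord_recr/= -IH itv_cellS// Rintegral_setU//.
- exact: measurable_itv.
- apply: integrableS ih => //.
  by apply: measurableU; exact: measurable_itv.
- rewrite disj_set2E; apply/eqP; rewrite -subset0 => x [].
  rewrite /cell/= !in_itv/= => /andP[_ xm] /andP[mx _].
  by move: (lt_le_trans xm mx); rewrite ltxx.
Qed.

Lemma test_functions_Lfun2 phi : test_functions `]0, 1[ phi -> phi \in Lfun2.
Proof.
move=> tphi.
have cphi := smooth_continuous (test_functions_smooth tphi).
have mphi := continuous_measurable_fun cphi.
apply: Lfun2_sqr_integral => //.
have i01 : mu.-integrable `[0, 1] (EFin \o (fun x => phi x ^+ 2)).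
  apply: continuous_compact_integrable; first exact: segment_compact.
  apply: continuous_subspaceT => x.
  by apply: (cvgM (cphi x) (cphi x)).
rewrite (_ : (\int[mu]_x _ = \int[mu]_(x in `[0%R, 1%R]) (phi x ^+ 2)%:E)%E).
  by apply: integrable_lty => //; exact: measurable_itv.
rewrite [RHS]integral_mkcond; apply: eq_integral => x _; rewrite patchE.
case: ifPn => //; rewrite notin_setE => x01.
rewrite (test_functions_out tphi) ?expr0n//.
by apply: contra_not x01; exact: subset_itv_oo_cc.
Qed.

Lemma test_functions_bounded phi : test_functions `]0, 1[ phi ->
  exists2 M : R, 0 <= M & forall x, `|phi x| <= M.
Proof.
move=> tphi.
have cphi := smooth_continuous (test_functions_smooth tphi).
have [c _ cM] := @EVT_max R (fun x => `|phi x|) 0 1 ler01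
  (continuous_subspaceT (fun x => cvg_norm (cphi x))).
exists `|phi c| => // x.
have [x01|x01] := boolP (x \in `]0, 1[).
  by apply: cM; exact: subset_itv_oo_cc x01.
by rewrite (test_functions_out tphi) ?normr0//; exact/negP.
Qed.

Lemma Rintegral_derive1_cell phi n k : (0 < n)%N -> smooth phi ->
  \int[mu]_(x in cell n k) derive1 phi x =
  phi (k.+1%:R / n%:R) - phi (k%:R / n%:R).
Proof.
move=> n0 sphi; have cdphi := smooth_continuous (smooth_derive1 sphi).
have cphi := smooth_continuous sphi.
have kn : k%:R / n%:R < k.+1%:R / n%:R :> R.
  by rewrite ltr_pM2r ?invr_gt0 ?ltr0n// ltr_nat.
rewrite /cell Rintegral_itv_bndo_bndc.
  rewrite /Rintegral (@continuous_FTC2 _ (derive1 phi) phi)//.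
  - exact: continuous_subspaceT.
  - split; first by move=> x _; exact: smooth_derivable.
      by apply: cvg_at_right_filter; exact: cphi.
    by apply: cvg_at_left_filter; exact: cphi.
apply: (@integrableS _ _ _ mu `[k%:R / n%:R, k.+1%:R / n%:R]) => //.
  exact: subset_itv_co_cc.
apply: continuous_compact_integrable; first exact: segment_compact.
exact: continuous_subspaceT.
Qed.

Lemma dot_test_cells n (f phi : R -> R) : (0 < n)%N ->
  test_functions `]0, 1[ phi -> f \in Lfun2 -> 
  dot f phi = \sum_(k < n) \int[mu]_(x in cell n k) (f x * phi x).
Proof.
move=> n0 tphi fL2.
rewrite -Rintegral_cells//; last first.
  exact: integrable_dot fL2 (test_functions_Lfun2 tphi).
rewrite divff ?pnatr_eq0 -?lt0n// [RHS]Rintegral_mkcond; apply: eq_Rintegral.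
move=> x _; rewrite patchE; case: ifPn => //; rewrite notin_setE => x01.
rewrite (test_functions_out tphi) ?mulr0//.
by apply: contra_not x01; exact: subset_itv_oo_co.
Qed.

Lemma cell_sub01 n k : (k < n)%N -> cell n k `<=` (`[0, 1] : set R).
Proof.
move=> kn x; rewrite /cell/= !in_itv/= => /andP[kx xk].
rewrite (le_trans _ kx) ?divr_ge0//= (le_trans (ltW xk))//.
by rewrite ler_pdivrMr ?ltr0n ?(leq_ltn_trans _ kn)// mul1r ler_nat.
Qed.

Lemma continuous_integrable_cell n k (f : R -> R) : (k < n)%N ->
  continuous f -> mu.-integrable (cell n k) (EFin \o f).
Proof.
move=> kn cf; apply: (@integrableS _ _ _ mu `[0, 1]) => //.
- exact: measurable_itv.
- exact: cell_sub01.
- apply: continuous_compact_integrable; first exact: segment_compact.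
  exact: continuous_subspaceT.
Qed.

(** The boundary terms of the summation by parts vanish with [phi] at 0 and 1:
    only the [n.-1] jumps between consecutive cells remain. *)
Lemma dot_step_derive1 n g phi : (0 < n)%N -> step_functions n g ->
  test_functions `]0, 1[ phi -> g \_ `[0, 1] \in Lfun2 ->
  dot (g \_ `[0, 1]) (derive1 phi) =
  - \sum_(k < n.-1) (g (k.+1%:R / n%:R) - g (k%:R / n%:R)) *
    phi (k.+1%:R / n%:R).
Proof.
move=> n0 sg tphi gL2; have sphi := test_functions_smooth tphi.
rewrite (dot_test_cells n0 (test_functions_derive1 tphi) gL2).
transitivity (\sum_(k < n) g (k%:R / n%:R) *
    (phi (k.+1%:R / n%:R) - phi (k%:R / n%:R))).
  apply: eq_bigr => k _; rewrite -Rintegral_derive1_cell//.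
  rewrite -RintegralZl; last 2 first.
  - exact: measurable_itv.
  - apply: continuous_integrable_cell => //.
    exact: smooth_continuous (smooth_derive1 sphi).
  apply: eq_Rintegral => x; rewrite inE => xk.
  rewrite patchE mem_set; last exact: cell_sub01 xk.
  by rewrite (step_functions_cell sg _ xk).
case: n n0 sg => // n _ sg.
rewrite (summation_by_parts (fun k => g (k%:R / n.+1%:R))
  (fun k => phi (k%:R / n.+1%:R))).
rewrite divff ?pnatr_eq0// mul0r !(test_functions_out tphi).
- by rewrite !mulr0 subrr sub0r.
- by rewrite /= in_itv/= ltxx.
- by rewrite /= in_itv/= ltxx andbF.
Qed.

(** [phi ^+ 2] is Lipschitz with constant [2 * M * M'], where [M] and [M'] bound
    [phi] and its derivative, so on each cell of length [1/n] its value at the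
    right end exceeds its mean by at most [2 * M * M' / n]. *)
Lemma riemann_sum_sqr_le phi : test_functions `]0, 1[ phi ->
  exists2 L, 0 <= L & forall n, (0 < n)%N ->
    \sum_(k < n.-1) phi (k.+1%:R / n%:R) ^+ 2 / n%:R <=
    dot phi phi + L * n%:R^-1.
Proof.
move=> tphi; have sphi := test_functions_smooth tphi.
have phiL2 := test_functions_Lfun2 tphi.
have [M M0 phiM] := test_functions_bounded tphi.
have [M' M'0 phiM'] := test_functions_bounded (test_functions_derive1 tphi).
exists (2 * M * M') => [|n n0]; first by rewrite !mulr_ge0.
have n0' : 0 < n%:R :> R by rewrite ltr0n.
have lip x y : x <= y -> phi y ^+ 2 <= phi x ^+ 2 + 2 * M * M' * (y - x).
  have dphi (z : R) : z \in `]x, y[ -> is_derive z 1 phi (derive1 phi z).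
    by rewrite derive1E => _; apply/derivableP/smooth_derivable.
  move=> xy; have [c _ phic] := MVT_segment xy dphi
    (continuous_subspaceT (smooth_continuous sphi)).
  rewrite -lerBlDl subr_sqr phic.
  apply: le_trans (ler_norm _) _.
  rewrite !normrM (ger0_norm (_ : 0 <= y - x)) ?subr_ge0//.
  rewrite mulrAC ler_wpM2r ?subr_ge0// mulrC; apply: ler_pM => //.
  by apply: le_trans (ler_normD _ _) _; have := phiM x; have := phiM y; lra.
rewrite (dot_test_cells n0 tphi phiL2).
have cell_le k : (k < n)%N -> phi (k.+1%:R / n%:R) ^+ 2 / n%:R <=
    \int[mu]_(x in cell n k) (phi x * phi x) + 2 * M * M' * n%:R^-1 ^+ 2.
  move=> kn.
  have len : fine (mu (cell n k)) = n%:R^-1.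
    rewrite /cell lebesgue_measure_itv/= lte_fin ltr_pM2r ?invr_gt0// ltr_nat.
    by rewrite ltnSn -EFinB/= -mulrBl -natr1 addrAC subrr add0r mul1r.
  have mcell : measurable (cell n k : set R) by exact: measurable_itv.
  have icst (c : R) : mu.-integrable (cell n k) (EFin \o cst c).
    by apply: continuous_integrable_cell => // x; exact: cvg_cst.
  have csqr : continuous (fun x => phi x * phi x).
    by move=> x; apply: cvgM; exact: smooth_continuous sphi x.
  have isqr := continuous_integrable_cell kn csqr.
  have ccst c : \int[mu]_(x in cell n k) c = c / n%:R.
    by rewrite Rintegral_cst// -[in RHS]len.
  rewrite [n%:R^-1 ^+ 2]expr2 mulrA -(ccst (phi _ ^+ 2)).
  rewrite -(ccst (_ / n%:R)) -RintegralD//; last exact: icst.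
  apply: le_Rintegral => //.
  - exact: icst.
  - apply: continuous_integrable_cell => // x.
    by apply: cvgD; [exact: csqr|exact: cvg_cst].
  - move=> x; rewrite /cell/= in_itv/= => /andP[kx xk].
    apply: le_trans (lip _ _ (ltW xk)) _; rewrite -expr2 lerD2l ler_wpM2l//.
      by rewrite !mulr_ge0.
    rewrite lerBlDl; apply: le_trans (lerD kx (lexx _)).
    by rewrite -natr1 mulrDl mul1r.
apply: (@le_trans _ _ (\sum_(k < n) phi (k.+1%:R / n%:R) ^+ 2 / n%:R)).
  case: n n0 n0' {cell_le} => // n _ n0'.
  by rewrite big_ord_recr/= lerDl divr_ge0 ?sqr_ge0 ?ltW.
apply: (@le_trans _ _ (\sum_(k < n) (\int[mu]_(x in cell n k) (phi x * phi x)
  + 2 * M * M' * n%:R^-1 ^+ 2))).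
  by apply: ler_sum => k _; exact: cell_le.
rewrite big_split/= sumr_const card_ord lerD2l -[leLHS]mulr_natr le_eqVlt.
by apply/orP; left; apply/eqP; field; rewrite gt_eqF.
Qed.

Lemma dot_step_sqr_le phi : test_functions `]0, 1[ phi ->
  exists2 L, 0 <= L & forall n g, (0 < n)%N -> step_functions n g ->
    g \_ `[0, 1] \in Lfun2 ->
    dot (g \_ `[0, 1]) (derive1 phi) ^+ 2 <=
    step_energy n g * (dot phi phi + L * n%:R^-1).
Proof.
move=> tphi; have [L L0 phiL] := riemann_sum_sqr_le tphi.
exists L => // n g n0 sg gL2; rewrite (dot_step_derive1 n0 sg tphi gL2) sqrrN.
have n0' : 0 < n%:R :> R by rewrite ltr0n.
apply: le_trans (sum_cauchy_schwarz _ _ _ n0') _.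
apply: ler_wpM2l (phiL n n0).
by apply: sumr_ge0 => k _; rewrite mulr_ge0 ?sqr_ge0 ?ltW.
Qed.

End discrete.

(** * Weak derivatives *)

Section weak_derivatives.
Context {R : realType}.
Implicit Types (f g h phi : R -> R).
Local Notation mu := (@lebesgue_measure R).
Local Notation Lfun2 := (Lfun mu 2%:E).
Local Notation dot := (dot mu).

Lemma Lfun2_restrict (D : set R) f :
  measurable D -> f \in Lfun2 -> f \_ D \in Lfun2.
Proof.
move=> mD fL2; have mf := Lfun2_measurable fL2.
apply: Lfun2_sqr_integral.
  by apply/(measurable_restrictT _ _).1 => //; exact: measurable_funTS.
apply: (@le_lt_trans _ _ (\int[mu]_x (f x ^+ 2)%:E)%E); last first.
  by rewrite -EFin_dot// ltry.
apply: ge0_le_integral => //.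
- by move=> x _; rewrite lee_fin sqr_ge0.
- apply/measurable_EFinP; apply: measurable_funX.
  by apply/(measurable_restrictT _ _).1 => //; exact: measurable_funTS.
- by apply/measurable_EFinP; exact: measurable_funX.
- move=> x _; rewrite lee_fin patchE; case: ifPn => // _.
  by rewrite expr0n sqr_ge0.
Qed.

Lemma Lfun2_integrable01 f : f \in Lfun2 -> mu.-integrable `]0, 1[ (EFin \o f).
Proof.
move=> fL2.
(* On ]0, 1[, [f] is its own product with the indicator of [0, 1], which is
   square-integrable because the interval has finite length. *)
have i1 : (\1_`[0, 1] : R -> R) \in Lfun2.
  apply: Lfun2_sqr_integral; first exact: measurable_indic.
  under eq_integral do
    rewrite indicE -natrX -[(_ ^ 2)%N]/((_ * _)%N) mulnb andbb -indicE.
  rewrite integral_indic// setIT.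
  rewrite [X in (X < _)%E](lebesgue_measure_itv `[0, 1])/= lte_fin ltr01.
  by rewrite sube0 ltry.
have i01 : mu.-integrable `]0, 1[ (EFin \o (fun x => f x * \1_`[0, 1] x)).
  by apply: integrableS (integrable_dot fL2 i1) => //; exact: measurable_itv.
apply: eq_integrable i01 => // x; rewrite inE => x01.
rewrite /= indicE mem_set ?mulr1//.
exact: subset_itv_oo_cc x01.
Qed.

(** Local integrability controls [f] on the support of [phi] only, which is
    all that the product sees. *)
Lemma locally_integrable_test (A : set R) f phi : locally_integrable A f ->
  test_functions A phi ->
  mu.-integrable A (EFin \o (fun x => f x * phi x)).
Proof.
move=> [mf oA fK] tphi; have [sphi [cK KA]] := tphi.
set K := closure _ in cK KA.
have mA : measurable A by exact: open_measurable.
have mK : measurable K by exact: compact_measurable.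
have cphi := smooth_continuous sphi.
have mfphi : measurable_fun A (fun x => f x * phi x).
  apply: measurable_funM => //; apply: measurable_funTS.
  exact: continuous_measurable_fun.
have [M M0 phiM] : exists2 M : R, 0 <= M & forall x, K x -> `|phi x| <= M.
  have [M [_ hM]] := compact_bounded
    (continuous_compact (continuous_subspaceT cphi) cK).
  exists (`|M| + 1) => [|x Kx]; first by rewrite addr_ge0.
  apply: (hM (`|M| + 1)); last by exists x.
  by rewrite (le_lt_trans (ler_norm _))// ltrDl.
have ifK : mu.-integrable K (EFin \o f).
  apply/integrableP; split; last exact: fK.
  by apply/measurable_EFinP; exact: measurable_funS mf.
have iK' : mu.-integrable K (EFin \o (fun x => f x * phi x)).
  have iMf : mu.-integrable K (fun x => M%:E * (EFin \o f) x)%E.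
    exact: integrableZl.
  apply: le_integrable iMf => //.
    by apply/measurable_EFinP; exact: measurable_funS mfphi.
  move=> x Kx; rewrite abseM /= lee_fin normrM mulrC ler_wpM2r//.
  by rewrite (ger0_norm M0) phiM.
have : mu.-integrable A ((EFin \o (fun x => f x * phi x)) \_ K).
  apply/integrable_restrict => //.
  by apply: integrableS iK' => //; exact: measurableI.
apply: eq_integrable => // x _; rewrite patchE; case: ifPn => //.
rewrite notin_setE => Kx; rewrite /= (_ : phi x = 0) ?mulr0//.
by apply/eqP/negP => px; apply/Kx/subset_closure; exact/negP.
Qed.

Lemma Rintegral_test_dot (A D : set R) f phi :
  test_functions A phi -> A `<=` D ->
  \int[mu]_(x in A) (f x * phi x) = dot (f \_ D) phi.
Proof.
move=> tphi AD; rewrite Rintegral_mkcond; apply: eq_Rintegral => x _.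
rewrite !patchE; case: ifPn => xA.
  by rewrite mem_set//; apply: AD; rewrite inE in xA.
by rewrite (test_functions_out tphi) ?mulr0//; rewrite notin_setE in xA.
Qed.

(** The difference of two weak derivatives integrates to zero against every
    test function, so the fundamental lemma applies. *)
Lemma weak_derivative_unique l r f g h :
  is_weak_derivative `]l, r[ f g -> is_weak_derivative `]l, r[ f h ->
  {ae mu, forall x, `]l, r[%classic x -> g x = h x}.
Proof.
move=> [_ lg fg] [_ lh fh].
have lgh := locally_integrableB lg lh.
have : {ae mu, forall x, `]l, r[%classic x -> (g \- h) x = 0}.
  apply: locally_integrable_ae0 lgh _ => phi tphi.
  under eq_Rintegral do rewrite mulrBl.
  rewrite RintegralB//.
  - apply/eqP; rewrite subr_eq0 -eqr_opp; apply/eqP.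
    by rewrite -fg// -fh.
  - exact: locally_integrable_test.
  - exact: locally_integrable_test.
apply: filterS; first exact: (ae_filter_ringOfSetsType mu).
by move=> x /= gh /gh /eqP; rewrite subr_eq0 => /eqP.
Qed.

Lemma derive1_lin f g t (x : R) : smooth f -> smooth g ->
  derive1 (f \+ (t \*o g)) x = derive1 f x + t * derive1 g x.
Proof.
move=> sf sg; have df := @smooth_derivable R f x sf.
have dg := @smooth_derivable R g x sg.
rewrite !derive1E deriveD//; last exact: derivableZ.
by rewrite deriveZ.
Qed.

(** A distributional derivative that is bounded for the quadratic norm is a
    square-integrable function: Riesz representation of
    [phi |-> - \int f phi'].  It keeps the bound, which carries the energy
    estimate over to the weak derivative. *)
Lemma bounded_weak_derivative f (c : R) : 0 <= c ->
  f \_ `[0, 1] \in Lfun2 ->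
  (forall phi, test_functions `]0, 1[ phi ->
    dot (f \_ `[0, 1]) (derive1 phi) ^+ 2 <= c * dot phi phi) ->
  exists2 g, is_weak_derivative `]0, 1[ f g & g \in Lfun2 /\ dot g g <= c.
Proof.
move=> c0 fL2 fc; set F := f \_ _ in fL2 fc.
have subcc : `]0, 1[ `<=` (`[0, 1] : set R) by exact: subset_itv_oo_cc.
have oo : open (`]0, 1[%classic : set R) by exact: interval_open.
have dL2 phi : test_functions `]0, 1[ phi -> derive1 phi \in Lfun2.
  by move=> tphi; exact: test_functions_Lfun2 (test_functions_derive1 tphi).
have [g gL2 [gc gE]] : exists2 g, g \in Lfun2 & dot g g <= c /\
    forall phi, test_functions `]0, 1[ phi ->
      - dot F (derive1 phi) = dot g phi.
  apply: riesz_subspace => //.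
  - exact: test_functions_cst0.
  - exact: test_functions_Lfun2.
  - by move=> *; exact: test_functions_lin.
  - move=> phi psi t tphi tpsi.
    rewrite (_ : derive1 _ = derive1 phi \+ (t \*o derive1 psi)).
      rewrite dotDr ?dotZr ?dL2//; first by rewrite mulrN opprD.
      by apply: Lfun2Z; exact: dL2.
    by apply/funext => x; rewrite derive1_lin//; [case: tphi|case: tpsi].
  - by move=> phi tphi; rewrite sqrrN; exact: fc.
exists g => //; split.
- apply: open_integrable_locally => //.
  apply: eq_integrable (Lfun2_integrable01 fL2) => // x; rewrite inE => x01.
  by rewrite /= /F patchE mem_set//; exact: subcc.
- by apply: open_integrable_locally => //; exact: Lfun2_integrable01.
- move=> phi tphi.
  rewrite (Rintegral_test_dot _ (test_functions_derive1 tphi) subcc).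
  rewrite -[LHS]opprK gE//; congr (- _).
  by rewrite (Rintegral_test_dot _ tphi (@subsetT _ _)) patch_setT.
Qed.

End weak_derivatives.

(** * The lower bound *)

Section energy.
Context {R : realType}.
Implicit Types (f g h phi : R -> R).
Local Notation mu := (@lebesgue_measure R).
Local Notation Lfun2 := (Lfun mu 2%:E).
Local Notation dot := (dot mu).

Lemma Lnorm2_dot h : measurable_fun setT h ->
  ('N[mu]_2%:E[EFin \o h] < +oo)%E ->
  h \in Lfun2 /\ dot h h = (fine 'N[mu]_2%:E[EFin \o h]) ^+ 2.
Proof.
move=> mh hoo; have hL2 : h \in Lfun2.
  by rewrite inE; apply/andP; split; rewrite inE.
split=> //; apply: EFin_inj; rewrite EFin_dot// -Lnorm2E.
rewrite -[X in (X `^ 2)%E]fineK; last by rewrite ge0_fin_numE// Lnorm_ge0.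
by rewrite poweR_EFin powR_mulrn// fine_ge0// Lnorm_ge0.
Qed.

Lemma step_energy_ge0 n g : 0 <= step_energy n g.
Proof. by apply: sumr_ge0 => k _; rewrite mulr_ge0 ?sqr_ge0. Qed.

(** If the inequality failed by some margin [e], then [dot_step_sqr_le] and the
    convergence of both of its sides would make every energy of large index
    at least [c + e], against the choice of [c]. *)
Lemma dot_derive1_le_energy (fn : nat -> R -> R) f phi (c : R) :
  (forall n, (0 < n)%N -> step_functions n (fn n)) ->
  f \_ `[0, 1] \in Lfun2 ->
  L2norm `[0, 1] (fn n \- f) @[n --> \oo] --> 0%E ->
  (limn_einf (fun n => (step_energy n (fn n))%:E) <= c%:E)%E ->
  test_functions `]0, 1[ phi ->
  dot (f \_ `[0, 1]) (derive1 phi) ^+ 2 <= c * dot phi phi.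
Proof.
move=> sfn fL2 fnf Ec tphi.
have dphiL2 := test_functions_Lfun2 (test_functions_derive1 tphi).
set F := f \_ _ in fL2 *.
pose G n := (fn n) \_ `[0, 1].
pose N n : \bar R := ('N[mu]_2%:E[EFin \o (G n \- F)%R])%E.
have /fine_cvgP[Nfin N0] : N n @[n --> \oo] --> 0%E.
  rewrite (_ : N = (fun n => L2norm `[0, 1] (fn n \- f)))//.
  apply/funext => n; rewrite /N /L2norm; congr Lnorm; apply/funext => x /=.
  by rewrite /G /F !patchE; case: ifPn => // _; rewrite subr0.
have [L L0 phiL] := dot_step_sqr_le tphi.
(* A step function at finite distance from [F] is square-integrable like [F];
   the convergence provides this for all large indices. *)
have GL2 : \forall n \near \oo, [/\ (0 < n)%N, G n \in Lfun2 &
    dot (G n \- F) (G n \- F) = fine (N n) ^+ 2].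
  near=> n.
  have n0 : (0 < n)%N by near: n; exists 1%N.
  have mG : measurable_fun setT (G n \- F).
    apply: measurable_funB; last exact: Lfun2_measurable fL2.
    apply/(measurable_restrictT _ _).1; first exact: measurable_itv.
    exact: step_functions_measurable (sfn n n0).
  have Noo : (N n < +oo)%E.
    by rewrite -ge0_fin_numE ?Lnorm_ge0//; near: n.
  have [DL2 DN] := Lnorm2_dot mG Noo; split => //.
  rewrite (_ : G n = (G n \- F) \+ F); first exact: Lfun2D.
  by apply/funext => x /=; rewrite subrK.
pose A n := dot (G n) (derive1 phi).
have Acvg : A n @[n --> \oo] --> dot F (derive1 phi).
  apply/subr_cvg0/norm_cvg0P.
  apply: (@squeeze_cvgr _ _ _ _ (cst 0)
    (fun n => fine (N n) * Num.sqrt (dot (derive1 phi) (derive1 phi)))).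
  - near=> n; rewrite normr_ge0/=.
    have [n0 GnL2 DN] : [/\ (0 < n)%N, G n \in Lfun2 &
      dot (G n \- F) (G n \- F) = fine (N n) ^+ 2] by near: n.
    have N0n : 0 <= fine (N n) by rewrite fine_ge0// Lnorm_ge0.
    rewrite /A -dotBl// -sqrtr_sqr -[fine (N n)]ger0_norm// -sqrtr_sqr.
    rewrite -sqrtrM ?sqr_ge0// ler_wsqrtr// -DN.
    by apply: dot_cauchy_schwarz => //; exact: Lfun2B.
  - exact: cvg_cst.
  - rewrite -(mul0r (Num.sqrt (dot (derive1 phi) (derive1 phi)))).
    by apply: cvgM; [exact: N0|exact: cvg_cst].
have harm : n%:R^-1 @[n --> \oo] --> (0 : R).
  apply/gtr0_cvgV0; last exact: cvgr_idn.
  by exists 1%N => // n /= n0; rewrite ltr0n.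
set K := dot phi phi; have K0 : 0 <= K by exact: dot_ge0.
have weak (e : R) : 0 < e -> dot F (derive1 phi) ^+ 2 <= (c + e) * K.
  move=> e0; rewrite leNgt; apply/negP => lt.
  have cvg : A n * A n - (c + e) * (K + L * n%:R^-1) @[n --> \oo] -->
      dot F (derive1 phi) ^+ 2 - (c + e) * (K + L * 0).
    rewrite expr2; apply: cvgB; first exact: cvgM.
    apply: cvgM; first exact: cvg_cst.
    apply: cvgD; first exact: cvg_cst.
    by apply: cvgM => //; exact: cvg_cst.
  have lim0 : 0 < dot F (derive1 phi) ^+ 2 - (c + e) * (K + L * 0).
    by rewrite mulr0 addr0 subr_gt0.
  have pos := cvgr_gt _ cvg _ lim0.
  have : ((c + e)%:E <= limn_einf (fun n => (step_energy n (fn n))%:E))%E.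
    apply: limn_einf_ge; near=> n.
    have [n0 GnL2 _] : [/\ (0 < n)%N, G n \in Lfun2 &
      dot (G n \- F) (G n \- F) = fine (N n) ^+ 2] by near: n.
    rewrite lee_fin leNgt; apply/negP => En.
    have : (c + e) * (K + L * n%:R^-1) < A n * A n.
      by rewrite -subr_gt0; near: n; exact: pos.
    apply/negP; rewrite -leNgt -expr2.
    apply: le_trans (phiL n (fn n) n0 (sfn n n0) GnL2) _.
    by rewrite ler_wpM2r ?(ltW En)// addr_ge0// mulr_ge0// invr_ge0.
  move=> /le_trans/(_ Ec); rewrite lee_fin.
  by rewrite gerDl leNgt e0.
apply/ler_addgt0Pr => e e0.
have K1 : 0 < K + 1 by rewrite ltr_wpDl.
apply: le_trans (weak (e / (K + 1)) (divr_gt0 e0 K1)) _.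
rewrite mulrDl lerD2l mulrAC ler_pdivrMr// ler_wpM2l ?(ltW e0)//.
by rewrite lerDl.
Unshelve. all: by end_near. Qed.

Lemma energy_weak_derivative (fn : nat -> R -> R) f :
  (forall n, (0 < n)%N -> step_functions n (fn n)) ->
  f \_ `[0, 1] \in Lfun2 ->
  L2norm `[0, 1] (fn n \- f) @[n --> \oo] --> 0%E ->
  (limn_einf (fun n => (step_energy n (fn n))%:E) < +oo)%E ->
  exists2 g, is_weak_derivative `]0, 1[ f g &
    g \in Lfun2 /\
    ((dot g g)%:E <= limn_einf (fun n => (step_energy n (fn n))%:E))%E.
Proof.
move=> sfn fL2 fnf.
set E := limn_einf _ => Eoo.
have E0 : (0 <= E)%E.
  by apply: limn_einf_ge; apply: nearW => n; rewrite lee_fin step_energy_ge0.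
have Efin : E \is a fin_num by rewrite ge0_fin_numE.
have [phi tphi|g fg [gL2 gE]] := bounded_weak_derivative (fine_ge0 E0) fL2.
  by apply: dot_derive1_le_energy sfn fL2 fnf _ tphi; rewrite fineK.
exists g => //; split=> //.
by rewrite -[E]fineK// lee_fin.
Qed.

Lemma integral_sqr_ae_eq_le (D : set R) f g : measurable D ->
  measurable_fun D f -> g \in Lfun2 -> {ae mu, forall x, D x -> f x = g x} ->
  (\int[mu]_(x in D) (`|f x| ^+ 2)%:E <= (dot g g)%:E)%E.
Proof.
move=> mD mf gL2 fg; have mg := Lfun2_measurable gL2.
have mg2 (E : set R) :
    measurable E -> measurable_fun E (fun x => (g x ^+ 2)%:E).
  move=> mE; apply/measurable_EFinP; apply: measurable_funX.
  exact: measurable_funTS.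
rewrite EFin_dot//; apply: (@le_trans _ _ (\int[mu]_(x in D) (g x ^+ 2)%:E)%E).
  under eq_integral do rewrite real_normK ?num_real//.
  rewrite le_eqVlt; apply/orP; left; apply/eqP; apply: ae_eq_integral => //.
  - by apply/measurable_EFinP; exact: measurable_funX.
  - exact: mg2.
  - apply: filterS fg; first exact: (ae_filter_ringOfSetsType mu).
    by move=> x /= h Dx; rewrite h.
apply: ge0_subset_integral => //.
- exact: mg2.
- by move=> x _; rewrite lee_fin sqr_ge0.
Qed.

End energy.

Theorem lemma13 (R : realType) (fn : nat -> R -> R) (f : R -> R)
  (hstep : forall n : nat, (0 < n)%N -> step_functions n (fn n))
  (hf : L2 `[0, 1] f)
  (hcvg : L2norm `[0, 1] (fn n \- f) @[n --> \oo] --> 0%E) :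
  (sobolev_H1 `]0, 1[ f -> forall f' : R -> R, is_weak_derivative `]0, 1[ f f' ->
     (\int[@lebesgue_measure R]_(x in `]0%R, 1%R[) (`|f' x| ^+ 2)%:E
        <= limn_einf (fun n => (step_energy n (fn n))%:E))%E) /\
  (~ sobolev_H1 `]0, 1[ f ->
     (+oo <= limn_einf (fun n => (step_energy n (fn n))%:E))%E).
Proof.
have [Eoo|Eoo] := ltP (limn_einf (fun n => (step_energy n (fn n))%:E)) +oo%E;
  last by split=> // _ f' _; exact: le_trans (leey _) Eoo.
have [g fg [gL2 gE]] := energy_weak_derivative hstep hf hcvg Eoo.
split=> [_ f' ff'|].
  apply: le_trans gE; apply: integral_sqr_ae_eq_le gL2 _.
  - exact: measurable_itv.
  - by case: ff' => _ [].
  - exact: weak_derivative_unique ff' fg.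
move=> nH1; exfalso; apply: nH1; split.
  rewrite /= /L2/= (_ : f \_ `]0, 1[ = (f \_ `[0, 1]) \_ `]0, 1[).
    by apply: Lfun2_restrict.
  apply/funext => x; rewrite !patchE; case: ifPn => // x01.
  by rewrite mem_set//; rewrite inE in x01; exact: subset_itv_oo_cc x01.
by exists g => //; exact: Lfun2_restrict.
Qed.
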